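(* Let $k\ge 0$, $l\ge 1$, $n=k+l+1$, and let $f_{ij}\in\mathbf{F}_2[x_1,\dots,x_n]$ ($1\le i\le s$, $1\le j\le t_i$) be the polynomials of a truth table with intermediate variables $x_1,\dots,x_k$, output variable $x_{k+1}$ and input variables $x_{k+2},\dots,x_n$. Put $V_i=\{a\in\mathbf{F}_2^n : f_{i,1}(a)=\dots=f_{i,t_i}(a)=0\}$ and $V_F=\bigcup_{i=1}^s V_i$, and assume that $V_F$ is nonempty and that the truth table is well defined, i.e. the projection $\pi_k(V_F)\to\pi_{k+1}(V_F)$, $(a_{k+1},\dots,a_n)\mapsto(a_{k+2},\dots,a_n)$, is bijective. Let $>$ be a monomial ordering on $x_1,\dots,x_n$ which is of both $k$-elimination type and $(k+1)$-elimination type. Let $I_k=I(V_F)\cap\mathbf{F}_2[x_{k+1},\dots,x_n]$ be the $k$-th elimination ideal of $I(V_F)$, and let $G_k$ be a reduced Gröbner basis of $I_k$ with respect to (the restriction of) $>$. Then: (1) $I_k$ contains all the polynomial forms of the truth table; and (2) $G_k$ contains exactly one polynomial form of the truth table.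
   Context: $\mathbf{F}_2$ is the field with two elements. For $1\le m\le n-1$, $\pi_m:\mathbf{F}_2^n\to\mathbf{F}_2^{n-m}$ is the projection $(a_1,\dots,a_n)\mapsto(a_{m+1},\dots,a_n)$, and $\pi_0$ is the identity. For $V\subset\mathbf{F}_2^n$, $I(V)\subset\mathbf{F}_2[x_1,\dots,x_n]$ denotes the ideal of all polynomials vanishing at every point of $V$. A truth table with $s$ rows is given by finite lists of polynomials $f_{i,1},\dots,f_{i,t_i}\in\mathbf{F}_2[x_1,\dots,x_n]$, $i=1,\dots,s$; row $i$ stands for the system of equations $f_{i,1}=\dots=f_{i,t_i}=0$ over $\mathbf{F}_2$, and the solutions of the rows specify the value of the output variable $x_{k+1}$ for certain values of the input variables $(x_{k+2},\dots,x_n)$. A monomial ordering is of $m$-elimination type if every monomial involving at least one of $x_1,\dots,x_m$ is greater than every monomial in $\mathbf{F}_2[x_{m+1},\dots,x_n]$ (no condition when $m=0$). $\mathrm{LT}(f)$ denotes the leading term of $f$ with respect to $>$. A polynomial form of the truth table is a polynomial $f\in\mathbf{F}_2[x_{k+1},\dots,x_n]$ such that (i) $V(f)\supset\pi_k(V_F)$, where $V(f)\subset\mathbf{F}_2^{n-k}$ is the zero set of $f$, i.e. $f$ vanishes at every point of $\pi_k(V_F)$; and (ii) $\mathrm{LT}(f)=x_{k+1}$ with respect to $>$. *)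

(* Defs.v *)
From HB Require Import structures.
From mathcomp Require Import all_boot all_order all_algebra.
From mathcomp.multinomials Require Export mpoly.

Set Implicit Arguments.
Unset Strict Implicit.
Unset Printing Implicit Defensive.

Import GRing.Theory.
Local Open Scope ring_scope.

(* A monomial ordering is given by its strict relation [gt u v], i.e. u > v. *)
Record monomial_order (n : nat) (gt : rel 'X_{1..n}) : Prop := MonomialOrder {
  mo_irrefl : irreflexive gt;
  mo_trans : transitive gt;
  mo_total : forall u v, u != v -> gt u v || gt v u;
  mo_add : forall w u v, gt u v -> gt (u + w)%MM (v + w)%MM;
  mo_wf : well_founded (fun u v => gt v u)
}.

Definition elimination_type (n m : nat) (gt : rel 'X_{1..n}) : Prop :=
  forall u v : 'X_{1..n},
    (exists2 i : 'I_n, (i < m)%N & (0 < u i)%N) ->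
    (forall i : 'I_n, (i < m)%N -> v i = 0%N) ->
    gt u v.

(* Leading monomial and term for an arbitrary ordering ([mlead] is tied to     *)
(* degrevlex). The default 0%MM is the least monomial; LT 0 = 0.               *)
Definition LM (n : nat) (R : nzRingType) (gt : rel 'X_{1..n})
    (p : {mpoly R[n]}) : 'X_{1..n} :=
  foldr (fun u v => if gt u v then u else v) 0%MM (msupp p).

Definition LC (n : nat) (R : nzRingType) (gt : rel 'X_{1..n})
  (p : {mpoly R[n]}) : R := p@_(LM gt p).

Definition LT (n : nat) (R : nzRingType) (gt : rel 'X_{1..n})
  (p : {mpoly R[n]}) : {mpoly R[n]} := LC gt p *: 'X_[LM gt p].

Definition ideal_gen (n : nat) (R : comNzRingType) (S : {mpoly R[n]} -> Prop)
    (p : {mpoly R[n]}) : Prop :=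
  exists2 r : seq ({mpoly R[n]} * {mpoly R[n]}),
    forall c, c \in r -> S c.2 & p = \sum_(c <- r) c.1 * c.2.

(* A finite set of polynomials is given by a list, of which only membership    *)
(* matters.                                                                    *)
Definition groebner_basis (n : nat) (F : fieldType) (gt : rel 'X_{1..n})
    (I : {mpoly F[n]} -> Prop) (G : seq {mpoly F[n]}) : Prop :=
  (forall g, g \in G -> I g) /\
  (forall p, ideal_gen (fun t => exists2 g, g \in G & t = LT gt g) p <->
             ideal_gen (fun t => exists2 g, I g /\ g != 0 & t = LT gt g) p).

Definition reduced_groebner_basis (n : nat) (F : fieldType)
    (gt : rel 'X_{1..n}) (I : {mpoly F[n]} -> Prop)
    (G : seq {mpoly F[n]}) : Prop :=
  [/\ groebner_basis gt I G,
      forall g, g \in G -> LC gt g = 1 &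
      forall g, g \in G -> forall u, u \in msupp g ->
        ~ ideal_gen (fun t => exists2 h, h \in G /\ h != g & t = LT gt h)
            'X_[u]].

(* For m + p = n, the ring F[x_(m+1), ..., x_n] is {mpoly F[p]}; its variables *)
(* j < p sit in {mpoly F[n]} at the positions m + j (numbered from 0).         *)
Definition tail_var (m p n : nat) (e : (m + p)%N = n) (j : 'I_p) : 'I_n :=
  cast_ord e (rshift m j).

Definition proj (m p n : nat) (e : (m + p)%N = n) (T : Type) (a : 'rV[T]_n) :
  'rV[T]_p := \row_(j < p) a ord0 (tail_var e j).

Definition tail_mnm (m p n : nat) (e : (m + p)%N = n) (u : 'X_{1..p}) :
  'X_{1..n} := (\sum_(j < p) U_(tail_var e j) *+ u j)%MM.

Definition tail_mpoly (m p n : nat) (e : (m + p)%N = n) (R : comNzRingType)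
    (f : {mpoly R[p]}) : {mpoly R[n]} :=
  f \mPo [tuple 'X_(tail_var e j) | j < p].

Definition restrict_order (m p n : nat) (e : (m + p)%N = n)
    (gt : rel 'X_{1..n}) : rel 'X_{1..p} :=
  fun u v => gt (tail_mnm e u) (tail_mnm e v).

(* I \cap F[x_(m+1), ..., x_n], as an ideal of the subring.                    *)
Definition elimination_ideal (m p n : nat) (e : (m + p)%N = n)
    (R : comNzRingType) (I : {mpoly R[n]} -> Prop) : {mpoly R[p]} -> Prop :=
  fun f => I (tail_mpoly e f).

Definition vanishing_ideal (n : nat) (V : {set 'rV['F_2]_n}) :
    {mpoly 'F_2[n]} -> Prop :=
  fun f => forall a, a \in V -> f.@[a ord0] = 0.

Definition zero_set (n : nat) (fs : seq {mpoly 'F_2[n]}) : {set 'rV['F_2]_n} :=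
  [set a : 'rV_n | all (fun f : {mpoly 'F_2[n]} => f.@[a ord0] == 0) fs].

(* The set V_F of all solutions of the rows of a truth table; row i is the     *)
(* list [f i].                                                                 *)
Definition table_set (n s : nat) (f : 'I_s -> seq {mpoly 'F_2[n]}) :
  {set 'rV['F_2]_n} := \bigcup_(i < s) zero_set (f i).

Lemma split_k (k l : nat) : (k + l.+1 = k + l + 1)%N.
Proof. by rewrite addn1 addnS. Qed.

Lemma split_kS (k l : nat) : (k.+1 + l = k + l + 1)%N.
Proof. by rewrite addn1 addSn. Qed.

Definition bij_on (T U : finType) (A : {set T}) (B : {set U}) (g : T -> U) :
  Prop := {in A &, injective g} /\ g @: A = B.

(* Coordinates are x_1, ..., x_(k+l+1); [proj (erefl (1 + l)%N)] drops the     *)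
(* first coordinate x_(k+1) of (x_(k+1), ..., x_n).                            *)
Definition well_defined_table (k l s : nat)
    (f : 'I_s -> seq {mpoly 'F_2[k + l + 1]}) : Prop :=
  bij_on (@proj _ _ _ (split_k k l) 'F_2 @: table_set f)
         (@proj _ _ _ (split_kS k l) 'F_2 @: table_set f)
         (@proj _ _ _ (erefl (1 + l)%N) 'F_2).

(* In {mpoly 'F_2[l.+1]} = F_2[x_(k+1), ..., x_n] the output variable x_(k+1)  *)
(* is 'X_ord0.                                                                 *)
Definition polynomial_form (k l s : nat) (gt : rel 'X_{1..k + l + 1})
    (f : 'I_s -> seq {mpoly 'F_2[k + l + 1]}) (p : {mpoly 'F_2[l.+1]}) : Prop :=
  @proj _ _ _ (split_k k l) 'F_2 @: table_set f \subset zero_set [:: p] /\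
  LT (restrict_order (split_k k l) gt) p = 'X_ord0.

(* Main.v *)
(* Since the table is well defined, the output is a function of the inputs on  *)
(* the projected solution set W. Interpolating that function gives a           *)
(* polynomial h in the input variables such that x_(k+1) - h vanishes on W; by *)
(* (k+1)-elimination its leading term is x_(k+1). Hence some g in G_k has a    *)
(* leading monomial dividing x_(k+1). It is not 1, for then g = 1 would vanish *)
(* on the nonempty set W; so it is x_(k+1), and g is a polynomial form. A      *)
(* second one in G_k would contradict that G_k is reduced.                     *)

Require Import Defs.
From Stdlib Require Inverse_Image.
From mathcomp Require Import all_boot all_order all_algebra.

Set Implicit Arguments.
Unset Strict Implicit.
Unset Printing Implicit Defensive.

Import GRing.Theory.

Local Open Scope ring_scope.

(** If 0 > u, adding v gives v > u + v for every v, an infinite descent that well-foundedness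
    forbids. *)
Lemma monomial_order_gt0 (n : nat) (gt : rel 'X_{1..n}) u :
  monomial_order gt -> u != 0%MM -> gt u 0%MM.
Proof.
move=> hgt u0; case/orP: (mo_total hgt u0) => // lt_u0.
exfalso; elim: (mo_wf hgt 0%MM) => v _; apply.
by have := mo_add hgt v lt_u0; rewrite add0m; exact.
Qed.

(** The fold defining [LM] also compares with its default [0%MM]; this is harmless because 0 is the
    least monomial. *)
Lemma LM_eq (n : nat) (R : nzRingType) (gt : rel 'X_{1..n})
    (p : {mpoly R[n]}) u :
  monomial_order gt -> u \in msupp p ->
  (forall v, v \in msupp p -> v != u -> gt u v) -> LM gt p = u.
Proof.
move=> hgt; rewrite /LM.
have fold_mem s : foldr (fun u v => if gt u v then u else v) 0%MM s \in 0%MM :: s.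
  elim: s => [|w s IHs] /=; first by rewrite inE.
  case: ifP => _; first by rewrite !inE eqxx orbT.
  by move: IHs; rewrite !inE => /orP[->//|->]; rewrite !orbT.
elim: (msupp p : seq _) => // w s IHs.
rewrite inE => us max_u /=.
have max_s v : v \in s -> v != u -> gt u v.
  by move=> vs; apply: max_u; rewrite inE vs orbT.
case: (boolP (u \in s)) => [u_in|u_notin].
  rewrite (IHs u_in max_s); case: ifP => // gt_wu; apply/eqP/negPn/negP => wu.
  have gt_uw := max_u w (mem_head _ _) wu.
  by have := mo_trans hgt gt_wu gt_uw; rewrite (mo_irrefl hgt).
have <- : u = w by apply/eqP; rewrite (negPf u_notin) orbF in us.
case: ifP => // /negbT ngt; apply/eqP/negPn/negP => ne.
(* The maximum of the rest is either the default 0 or a true element of the list; u exceeds both. *)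
case/negP: ngt; move: (fold_mem s); rewrite inE => /orP[/eqP fold0|fold_s].
  by rewrite fold0 in ne *; apply: monomial_order_gt0; rewrite // eq_sym.
exact: max_s.
Qed.

Lemma LM_ge (n : nat) (R : nzRingType) (gt : rel 'X_{1..n})
    (p : {mpoly R[n]}) u :
  monomial_order gt -> u \in msupp p ->
  u != LM gt p -> gt (LM gt p) u.
Proof.
move=> hgt; rewrite /LM; elim: (msupp p : seq _) => // w s IHs.
rewrite inE => /orP[/eqP->|us] /=; case: ifP => [gt_w|/negbT ngt_w].
- by rewrite eqxx.
- by move=> ne; have := mo_total hgt ne; rewrite (negPf ngt_w).
- case: (u =P foldr (fun u v => if gt u v then u else v) 0%MM s) => [->//|/eqP ne _].
  exact: (mo_trans hgt gt_w (IHs us ne)).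
- exact: IHs.
Qed.

Lemma LM_eq0 (n : nat) (R : nzRingType) (gt : rel 'X_{1..n})
    (p : {mpoly R[n]}) :
  monomial_order gt -> LM gt p = 0%MM -> p = (p@_0%MM)%:MP.
Proof.
move=> hgt lm0; apply/mpolyP => u; rewrite mcoeffC.
case: (u =P 0%MM) => [->|/eqP u0]; first by rewrite mulr1.
rewrite mulr0; apply: memN_msupp_eq0; apply/negP => up.
have := LM_ge hgt up; rewrite lm0 => /(_ u0) lt_u.
have := mo_trans hgt lt_u (monomial_order_gt0 hgt u0).
by rewrite (mo_irrefl hgt).
Qed.

Lemma tail_var_inj m p n (e : (m + p)%N = n) : injective (tail_var e).
Proof. by move=> i j /cast_ord_inj/rshift_inj. Qed.

Lemma tail_mnm_tail (m p n : nat) (e : (m + p)%N = n) u j :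
  tail_mnm e u (tail_var e j) = u j.
Proof.
rewrite /tail_mnm mnm_sumE (bigD1 j) //= big1 => [|i ij].
  by rewrite mulmnE mnm1E eqxx mul1n addn0.
by rewrite mulmnE mnm1E (inj_eq (@tail_var_inj m p n e)) (negPf ij).
Qed.

Lemma tail_mnm_head (m p n : nat) (e : (m + p)%N = n) u (i : 'I_n) :
  (i < m)%N -> tail_mnm e u i = 0%N.
Proof.
move=> im; rewrite /tail_mnm mnm_sumE big1 // => j _.
rewrite mulmnE mnm1E; case: eqP => // eij.
by move: im; rewrite -eij /= ltnNge leq_addr.
Qed.

Lemma tail_mnmD (m p n : nat) (e : (m + p)%N = n) u v :
  tail_mnm e (u + v)%MM = (tail_mnm e u + tail_mnm e v)%MM.
Proof.
rewrite /tail_mnm -big_split /=; apply: eq_bigr => j _.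
by apply/mnmP=> i; rewrite !(mnmDE, mulmnE) mulnDr.
Qed.

(** The order is pulled back along [tail_mnm], which is injective (this gives totality) and additive
    (this gives compatibility with sums). *)
Lemma restrict_monomial_order (m p n : nat) (e : (m + p)%N = n) gt :
  monomial_order gt -> monomial_order (restrict_order e gt).
Proof.
move=> hgt; split=> [u|v u w|u v ne|w u v|].
- exact: (mo_irrefl hgt).
- exact: (mo_trans hgt).
- apply: (mo_total hgt); apply: contraNneq ne => euv.
  by apply/eqP/mnmP => j; rewrite -!(tail_mnm_tail e) euv.
- by rewrite /restrict_order !tail_mnmD; exact: mo_add.
- exact: Inverse_Image.wf_inverse_image (mo_wf hgt).
Qed.

(** Variable [ord0] of the small ring sits at position m of the large one, the last of the m + 1
    positions eliminated; at the earlier ones a tail monomial has exponent 0. *)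
Lemma restrict_elimination (m p n : nat) (e : (m + p.+1)%N = n) gt :
  elimination_type m.+1 gt ->
  forall u v : 'X_{1..p.+1}, (0 < u ord0)%N -> v ord0 = 0%N ->
  restrict_order e gt u v.
Proof.
move=> helim u v u0 v0; apply: helim => [|i].
  by exists (tail_var e ord0); rewrite ?tail_mnm_tail //= addn0.
rewrite ltnS leq_eqVlt => /orP[/eqP im|]; last exact: tail_mnm_head.
have -> : i = tail_var e ord0 by apply: val_inj; rewrite /= addn0.
by rewrite tail_mnm_tail.
Qed.

Lemma meval_tail_mpoly (m p n : nat) (e : (m + p)%N = n) (R : comNzRingType)
    (q : {mpoly R[p]}) (a : 'rV[R]_n) :
  (tail_mpoly e q).@[a ord0] = q.@[proj e a ord0].
Proof.
rewrite /tail_mpoly comp_mpoly_meval; apply: meval_eq => j.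
by rewrite tnth_mktuple mevalXU mxE.
Qed.

Lemma elimination_vanishing_idealP (m p n : nat) (e : (m + p)%N = n)
    (V : {set 'rV['F_2]_n}) q :
  elimination_ideal e (vanishing_ideal V) q <->
  @proj m p n e 'F_2 @: V \subset zero_set [:: q].
Proof.
split=> [hq|/subsetP hq a aV].
  apply/subsetP=> _ /imsetP[a aV ->].
  by rewrite inE /= andbT -meval_tail_mpoly hq.
rewrite meval_tail_mpoly; apply/eqP.
by have := hq _ (imset_f _ aV); rewrite inE /= andbT.
Qed.

(** Polynomials not involving $x_i$ are kept in the full ring, so that $x_{k+1} - h$ can be formed
    without an embedding. *)
Definition free_of (n : nat) (R : nzRingType) (i : 'I_n) (p : {mpoly R[n]}) :=
  forall v, v \in msupp p -> v i = 0%N.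

Section FreeOf.

Context (n : nat) (R : nzRingType) (i : 'I_n).

Lemma free_ofC c : free_of i (c%:MP : {mpoly R[n]}).
Proof.
by move=> v; rewrite msuppC; case: ifP => // _; rewrite inE => /eqP->; rewrite mnm0E.
Qed.

Lemma free_ofX j : j != i -> free_of i ('X_j : {mpoly R[n]}).
Proof.
by move=> ji v; rewrite msuppX inE => /eqP->; rewrite mnm1E (negPf ji).
Qed.

Lemma free_ofD (p q : {mpoly R[n]}) :
  free_of i p -> free_of i q -> free_of i (p + q).
Proof.
by move=> hp hq v /msuppD_le; rewrite mem_cat => /orP[/hp|/hq].
Qed.

Lemma free_ofM (p q : {mpoly R[n]}) :
  free_of i p -> free_of i q -> free_of i (p * q).
Proof.
move=> hp hq v /msuppM_le /allpairsP[[u w] /= [/hp hu /hq hw ->]].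
by rewrite mnmDE hu hw.
Qed.

End FreeOf.

(* Over F_2 the indicator of the point b is the product of the x_j + b_j + 1.  *)
Lemma interpolate (l : nat) (W : {set 'rV['F_2]_l.+1}) :
  {in W &, injective (@proj _ _ _ (erefl (1 + l)%N) 'F_2)} ->
  exists2 h : {mpoly 'F_2[l.+1]}, free_of ord0 h &
    forall b, b \in W -> h.@[b ord0] = b ord0 ord0.
Proof.
move=> injW.
(* The product runs over the input coordinates only, so $h$ does not involve the output variable;
   the output value of b is the coefficient. *)
pose h := \sum_(b in W) (b ord0 ord0)%:MP_[l.+1] *
  \prod_(j < l) ('X_(lift ord0 j) + (b ord0 (lift ord0 j) + 1)%:MP).
exists h.
  apply: (big_ind (free_of ord0)) => [||b _]; first exact: free_ofC.
    exact: free_ofD.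
  apply: free_ofM; first exact: free_ofC.
  apply: (big_ind (free_of ord0)) => [||j _]; first exact: free_ofC.
    exact: free_ofM.
  by apply: free_ofD; [apply: free_ofX | apply: free_ofC].
have F2D (x : 'F_2) : x + (x + 1) = 1 by case: x => [[|[|]]] // ?; apply: val_inj.
have F2N (x y : 'F_2) : x != y -> x + (y + 1) = 0.
  by case: x => [[|[|]]] // ?; case: y => [[|[|]]] // ? // _; apply: val_inj.
move=> b bW; rewrite raddf_sum (bigD1 b) //= [X in _ + X]big1 => [|c /andP[cW cb]].
  rewrite addr0 mevalM mevalC rmorph_prod big1 ?mulr1 // => j _.
  by rewrite /= mevalD mevalXU mevalC F2D.
rewrite mevalM rmorph_prod.
(* Here injectivity enters: distinct points of W differ in some input, and the factor at that input
   kills the term of c at b. *)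
have [j bcj] : exists j : 'I_l, b ord0 (lift ord0 j) != c ord0 (lift ord0 j).
  apply/existsP; apply: contraNT cb; rewrite negb_exists => /forallP eqbc.
  apply/eqP/injW => //; apply/rowP => j; rewrite !mxE.
  have -> : tail_var (erefl (1 + l)%N) j = lift ord0 j by apply: val_inj.
  by have := eqbc j; rewrite negbK => /eqP.
by rewrite (bigD1 j) //= mevalD mevalXU !mevalC F2N // mul0r mulr0.
Qed.

(** No monomial of $h$ involves the variable [ord0], so none cancels it and all lie below it by
    elimination. *)
Lemma LT_XsubC_free (l : nat) (R : nzRingType) (gt : rel 'X_{1..l.+1}) :
  monomial_order gt ->
  (forall u v : 'X_{1..l.+1}, (0 < u ord0)%N -> v ord0 = 0%N -> gt u v) ->
  forall h : {mpoly R[l.+1]}, free_of ord0 h -> LT gt ('X_ord0 - h) = 'X_ord0.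
Proof.
move=> hgt helim h hh.
have coefU : ('X_ord0 - h)@_U_(ord0) = 1.
  rewrite mcoeffB mcoeffX eqxx memN_msupp_eq0 ?subr0 //.
  by apply/negP=> /hh; rewrite mnm1E eqxx.
have lmU : LM gt ('X_ord0 - h) = U_(ord0)%MM.
  apply: LM_eq => // [|v]; first by rewrite mcoeff_msupp coefU oner_neq0.
  move=> /msuppB_le; rewrite mem_cat msuppX inE => /orP[/eqP->|/hh v0 _].
    by rewrite eqxx.
  by apply: helim; rewrite // mnm1E eqxx.
by rewrite /LT /LC lmU coefU scale1r.
Qed.

Lemma LT_monic (n : nat) (R : nzRingType) (gt : rel 'X_{1..n})
    (p : {mpoly R[n]}) :
  LC gt p = 1 -> LT gt p = 'X_[LM gt p].
Proof. by rewrite /LT => ->; rewrite scale1r. Qed.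

Lemma mpolyX_inj (n : nat) (R : nzRingType) :
  injective (fun u : 'X_{1..n} => 'X_[u] : {mpoly R[n]}).
Proof.
move=> u v euv; have := mem_head u [::].
by rewrite -(msuppX R) euv msuppX inE => /eqP.
Qed.

(** Compare coefficients at u: some summand must contain u, and every monomial of a multiple of
    ['X_[w]] is divisible by ['X_[w]]. *)
Lemma monomial_ideal_dvd (n : nat) (R : comNzRingType)
    (S : {mpoly R[n]} -> Prop) (u : 'X_{1..n}) :
  (forall t, S t -> exists w, t = 'X_[w]) -> ideal_gen S 'X_[u] ->
  exists2 w, S 'X_[w] & (w <= u)%MM.
Proof.
move=> monS [r rS eu].
have : (\sum_(c <- r) c.1 * c.2)@_u != 0 by rewrite -eu mcoeffX eqxx oner_neq0.
have [/hasP[c cr cu] _|/hasPn none] := boolP (has (fun c => (c.1 * c.2)@_u != 0) r).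
  have Sc := rS c cr; have [w ew] := monS _ Sc; exists w; rewrite -?ew //.
  move: cu; rewrite ew -mcoeff_msupp (perm_mem (msuppMX _ _)) => /mapP[v _ ->].
  by apply/mnm_lepP=> i; rewrite mnmDE leq_addr.
rewrite raddf_sum big_seq big1 ?eqxx // => c /none.
by rewrite negbK => /eqP.
Qed.

Lemma mnm_le_U (n : nat) (i : 'I_n) (w : 'X_{1..n}) :
  (w <= U_(i))%MM -> w = 0%MM \/ w = U_(i)%MM.
Proof.
move=> /mnm_lepP le_w; have := le_w i; rewrite mnm1E eqxx.
have w_off j : i != j -> w j = 0%N.
  by move=> ij; have := le_w j; rewrite mnm1E (negPf ij); case: (w j).
case wi: (w i) => [|[|]] // _; [left|right]; apply/mnmP => j.
  by rewrite mnm0E; case: (i =P j) => [<-|/eqP/w_off].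
by rewrite mnm1E; case: (i =P j) => [<-|/eqP/w_off].
Qed.

Theorem theorem1 (k l s : nat) (hl : (1 <= l)%N)
    (f : 'I_s -> seq {mpoly 'F_2[k + l + 1]})
    (hne : table_set f <> set0)
    (hwd : well_defined_table f)
    (gt : rel 'X_{1..k + l + 1})
    (hgt : monomial_order gt)
    (hk : elimination_type k gt)
    (hkS : elimination_type k.+1 gt)
    (Gk : seq {mpoly 'F_2[l.+1]})
    (hG : reduced_groebner_basis (restrict_order (split_k k l) gt)
            (elimination_ideal (split_k k l) (vanishing_ideal (table_set f)))
            Gk) :
  (forall p : {mpoly 'F_2[l.+1]}, polynomial_form gt f p ->
     elimination_ideal (split_k k l) (vanishing_ideal (table_set f)) p) /\
  (exists! p : {mpoly 'F_2[l.+1]}, p \in Gk /\ polynomial_form gt f p).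
Proof.
split=> [p [hp _]|]; first exact/elimination_vanishing_idealP.
have hgt' := restrict_monomial_order (split_k k l) hgt.
have helim := restrict_elimination (split_k k l) hkS.
rewrite /polynomial_form.
set gt' := restrict_order _ _ in hG hgt' helim *.
case: hG => [[GI Ggen] Gmonic Gred].
have lmX p : p \in Gk -> LT gt' p = 'X_ord0 -> LM gt' p = U_(ord0)%MM.
  by move=> pG; rewrite (LT_monic (Gmonic _ pG)); exact: mpolyX_inj.
have [g [gG ltg]] : exists g, g \in Gk /\ LT gt' g = 'X_ord0.
  case: hwd => injW _; have [h hfree hW] := interpolate injW.
  have lth := LT_XsubC_free hgt' helim hfree.
  have X_in : ideal_gen (fun t => exists2 g, g \in Gk & t = LT gt' g) 'X_ord0.
    apply/Ggen; exists [:: (1, 'X_ord0)]; last by rewrite big_seq1 mul1r.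
    move=> c; rewrite inE => /eqP-> /=.
    exists ('X_ord0 - h) => //; split.
      apply/elimination_vanishing_idealP/subsetP=> b bW.
      by rewrite inE /= andbT mevalB mevalXU hW // subrr.
    (* If $x_{k+1} - h$ were zero, $h$ would be $x_{k+1}$ itself, which is not free of that
       variable. *)
    apply/eqP=> h0; have := hfree U_(ord0)%MM.
    by rewrite -(subr0_eq h0) msuppX mem_head mnm1E eqxx => /(_ isT).
  have [|w [g gG /esym ew] /mnm_le_U w_cases] := monomial_ideal_dvd _ X_in.
    by move=> _ [g gG ->]; exists (LM gt' g); rewrite (LT_monic (Gmonic _ gG)).
  exists g; split=> //.
  case: w_cases => w_eq; rewrite w_eq in ew; last by [].
  have lm0 : LM gt' g = 0%MM.
    by move: ew; rewrite (LT_monic (Gmonic _ gG)) => /mpolyX_inj.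
  have g1 : g = 1.
    by rewrite (LM_eq0 hgt' lm0) -lm0; move: (Gmonic _ gG); rewrite /LC => ->.
  case/eqP/set0Pn: hne => a aV; have := GI _ gG a aV.
  by rewrite meval_tail_mpoly g1 meval1 => /eqP; rewrite oner_eq0.
exists g; split=> [|p [pG [_ ltp]]].
  by do 2?split=> //; apply/elimination_vanishing_idealP/GI.
apply/eqP/negPn/negP; rewrite eq_sym => pg.
(* The leading monomial of g lies in its own support, yet it is also the leading term of the other
   basis element p, against reducedness. *)
case: (Gred g gG U_(ord0)%MM).
  by rewrite -(lmX g) // mcoeff_msupp -/(LC _ _) (Gmonic _ gG) oner_neq0.
exists [:: (1, 'X_ord0)]; last by rewrite big_seq1 mul1r.
by move=> c; rewrite inE => /eqP->; exists p.
Qed.
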